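(* For every integer $k\geq 2$ there exists a finite, simple, connected graph of order $3k$ which has metric dimension $k$ and exactly one metric basis.
   Context: For vertices $u,v$ of a connected graph $G$, $d(u,v)$ is the distance between them. For an ordered set $W=\{w_1,\dots,w_k\}\subseteq V(G)$ and $v\in V(G)$, $r(v|W)=(d(v,w_1),\dots,d(v,w_k))$. $W$ is a resolving set if distinct vertices have distinct representations $r(\cdot|W)$. A resolving set of minimum cardinality is a metric basis; its cardinality is the metric dimension $\beta(G)$. *)

(* Defs.v *)
From mathcomp Require Import all_boot.

Set Implicit Arguments.
Unset Strict Implicit.
Unset Printing Implicit Defensive.

(* A finite simple graph is a symmetric irreflexive adjacency
   relation [e : rel T] on a [finType] of vertices. *)

Section MetricDimension.

Variables (T : finType) (e : rel T).
Implicit Types (u v w : T) (W : {set T}) (s : seq T).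

Definition simple_graph : Prop := symmetric e /\ irreflexive e.

Definition connected_graph : Prop := forall u v, connect e u v.

Definition has_walk u v n : bool :=
  [exists p : n.-tuple T, path e u p && (last u p == v)].

(* The least length of a walk from [u] to [v]. A shortest walk visits at most
   [#|T|] vertices, so lengths below [#|T|] suffice; the value is [#|T|] when
   [v] is not reachable from [u]. *)
Definition dist u v : nat := find (has_walk u v) (iota 0 #|T|).

Definition representation v s : seq nat := [seq dist v w | w <- s].

(* Whether W resolves the graph does not depend on the order in which its
   elements are listed, so W is a [{set T}], listed by [enum]. *)
Definition resolving W : bool := injectiveb (fun v => representation v (enum W)).

Definition metric_basis W : bool :=
  resolving W && [forall W' : {set T}, resolving W' ==> (#|W| <= #|W'|)].

(* The set of all vertices is resolving: see [resolving_setT]. *)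
Definition metric_dimension : nat :=
  #|[arg min_(W < [set: T] | resolving W) #|W|]|.

Lemma has_walkP u v n :
  reflect (exists p, [/\ path e u p, last u p = v & size p = n])
          (has_walk u v n).
Proof.
apply: (iffP existsP) => [[p /andP[ep /eqP pv]] | [p [ep pv sp]]].
  by exists p; rewrite size_tuple.
have sp' : size p == n by apply/eqP.
by exists (Tuple sp'); rewrite /= ep pv eqxx.
Qed.

Lemma dist_min u v p : path e u p -> last u p = v -> dist u v <= size p.
Proof.
move=> ep pv; case: (ltnP (size p) #|T|) => sp; last first.
  by apply: leq_trans sp; rewrite -[X in _ <= X](size_iota 0) find_size.
rewrite leqNgt; apply/negP => lt_p.
have /negP := negbT (before_find 0 lt_p); rewrite nth_iota // add0n.
by apply; apply/has_walkP; exists p.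
Qed.

Lemma dist_walk u v :
  connect e u v -> exists p, [/\ path e u p, last u p = v & size p = dist u v].
Proof.
move=> /connectP[q /shortenP[p ep up _] pv].
have sp : size p < #|T| by rewrite -[_.+1]/(size (u :: p)) -(card_uniqP up) max_card.
have hs : has (has_walk u v) (iota 0 #|T|).
  apply/hasP; exists (size p); first by rewrite mem_iota.
  by apply/has_walkP; exists p.
apply/has_walkP; have := nth_find 0 hs.
by rewrite nth_iota ?add0n // -[X in _ < X](size_iota 0) -has_find.
Qed.

Lemma dist_eq0 u v : (dist u v == 0) = (u == v).
Proof.
apply/idP/eqP => [/eqP d0 | ->]; last first.
  by rewrite -leqn0 (@dist_min _ _ [::]).
have T0 : 0 < #|T| by apply/card_gt0P; exists u.
have hs : has (has_walk u v) (iota 0 #|T|).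
  by rewrite has_find size_iota -/(dist u v) d0.
have := nth_find 0 hs; rewrite -/(dist u v) d0 nth_iota //.
by move=> /has_walkP[[|x p] [_ /= uv]].
Qed.

Lemma resolving_setT : resolving [set: T].
Proof.
apply/injectiveP => u v /eq_in_map eq_uv.
have := eq_uv v; rewrite mem_enum inE => /(_ isT) duv.
by apply/eqP; rewrite -dist_eq0 duv dist_eq0.
Qed.

Lemma card_metric_basis W : metric_basis W -> #|W| = metric_dimension.
Proof.
rewrite /metric_dimension => /andP[rW /forallP minW].
case: arg_minnP => [|W' rW' minW']; first exact: resolving_setT.
by apply/eqP; rewrite eqn_leq minW' // (implyP (minW W')).
Qed.

Lemma metric_basis_exists : exists W, metric_basis W.
Proof.
case: (arg_minnP (fun W => #|W|) resolving_setT) => W rW minW.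
by exists W; rewrite /metric_basis rW; apply/forallP => W'; apply/implyP/minW.
Qed.

End MetricDimension.

(* Main.v *)
Require Import Defs.
From mathcomp Require Import all_boot zify.

Set Implicit Arguments.
Unset Strict Implicit.
Unset Printing Implicit Defensive.

(** The graph is a clique on c_0, ..., c_(2k-1) together with independent
    vertices z_0, ..., z_(k-1), where z_i is adjacent to the c_a with
    i <= a < i + k.  Place the c_a on a cycle.  The neighbours of z_i form a
    half of the cycle, so z_i separates two of the 2k pairs of consecutive
    c_a, and c_a itself also separates only the two pairs containing it.
    Hence a resolving set has at least k elements.  If it contains c_m, then
    the element separating c_(m-1) from c_(m+1) is not c_m and separates one of
    the two pairs containing c_m; discarding c_m thus leaves a set that still
    separates at least 2k - 1 pairs, so there were more than k elements.
    The z_i do resolve the graph, and so form the only metric basis. *)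

Section Distance.

Variables (T : finType) (e : rel T).

Lemma resolvingP (W : {set T}) :
  reflect (forall u v, {in W, dist e u =1 dist e v} -> u = v) (resolving e W).
Proof.
apply: (iffP (injectiveP _)) => rW u v uv.
- by apply: rW; apply/eq_in_map => w; rewrite mem_enum => /uv.
- by apply: rW => w wW; move/eq_in_map: uv; apply; rewrite mem_enum.
Qed.

Lemma resolving_separates (W : {set T}) u v :
  resolving e W -> u != v -> exists2 w, w \in W & dist e u w != dist e v w.
Proof.
move=> /resolvingP rW /eqP neq_uv.
have [/exists_inP //|] := boolP [exists w in W, dist e u w != dist e v w].
rewrite negb_exists_in => /forall_inP same; case: neq_uv; apply: rW => w wW.
by apply/eqP; rewrite -[_ == _]negbK same.
Qed.

Lemma dist_eq1 u v :
  irreflexive e -> connected_graph e -> (dist e u v == 1) = e u v.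
Proof.
move=> e_irr e_conn; apply/eqP/idP => [d1 | euv].
  have [p [ep pv]] := dist_walk (e_conn u v); rewrite d1.
  by case: p ep pv => [|x []] //= + <-; rewrite andbT.
apply/eqP; rewrite eqn_leq (@dist_min _ _ _ _ [:: v]) /= ?euv //.
by rewrite lt0n dist_eq0; apply: contraTneq euv => ->; rewrite e_irr.
Qed.

End Distance.

(** Union bound. It is applied with [F := cut_pairs] and [n := 2], so that covering pairs of
    consecutive clique vertices bounds the size of a resolving set from below. *)
Lemma card_le_cover (I J : finType) (W : {set J}) (A : {set I})
    (F : J -> {set I}) n :
    (forall j, #|F j| <= n) ->
    {in A, forall i, exists2 j, j \in W & i \in F j} ->
  #|A| <= #|W| * n.
Proof.
move=> Fn covA; have sAF : A \subset \bigcup_(j in W) F j.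
  by apply/subsetP => i /covA[j jW iF]; apply/bigcupP; exists j.
apply: leq_trans (subset_leq_card sAF) _; rewrite -sum_nat_const.
elim/big_rec2: _ => [|j m B _ le_Bm]; first by rewrite cards0.
by rewrite (leq_trans (leq_card_setU _ _)) // leq_add.
Qed.

Lemma val_ordS n (i : 'I_n) : ordS i = (if i.+1 == n then 0 else i.+1) :> nat.
Proof.
rewrite /=; have := ltn_ord i; case: eqP => [-> _|neq_n lt_n].
  exact: modnn.
by apply: modn_small; lia.
Qed.

Section HalfCycleGraph.

Variable k : nat.

Notation vertex := ('I_(k + k) + 'I_k)%type.

Definition half_cycle_adj : rel vertex := fun u v =>
  match u, v with
  | inl a, inl b => a != b
  | inl a, inr i | inr i, inl a => i <= a < i + k
  | inr _, inr _ => false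
  end.

Notation e := half_cycle_adj.

Lemma half_cycle_sym : symmetric e.
Proof. by move=> [a|i] [b|j] //=; rewrite eq_sym. Qed.

Lemma half_cycle_irr : irreflexive e.
Proof. by move=> [a|i] //=; rewrite eqxx. Qed.

Lemma half_cycle_adj_lshift (i : 'I_k) : e (inl (lshift k i)) (inr i).
Proof. by have := ltn_ord i; rewrite /=; lia. Qed.

Lemma half_cycle_connected : connected_graph e.
Proof.
have conn_cl a v : connect e (inl a) v.
  have conn_ll b : connect e (inl a) (inl b).
    have [->|neq_ab] := eqVneq a b; first exact: connect0.
    exact/connect1.
  case: v => [//|i]; apply: connect_trans (conn_ll (lshift k i)) _.
  exact/connect1/half_cycle_adj_lshift.
case=> [a|i] v; first exact: conn_cl.
apply: connect_trans (conn_cl (lshift k i) v).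
by apply: connect1; rewrite half_cycle_sym half_cycle_adj_lshift.
Qed.

Lemma dist_half_cycle_eq1 u v : (dist e u v == 1) = e u v.
Proof. exact: dist_eq1 half_cycle_irr half_cycle_connected. Qed.

Lemma dist_inl_inl (a b : 'I_(k + k)) :
  dist e (inl a) (inl b) = (a != b) :> nat.
Proof.
have [->|neq_ab] /= := eqVneq a b; apply/eqP; first by rewrite dist_eq0.
by rewrite dist_half_cycle_eq1.
Qed.

Lemma dist_inl_inr (a : 'I_(k + k)) (i : 'I_k) :
  dist e (inl a) (inr i) = if i <= a < i + k then 1 else 2.
Proof.
case: ifP => ai; apply/eqP; first by rewrite dist_half_cycle_eq1.
rewrite eqn_leq; apply/andP; split.
  (* c_i is always a neighbour of z_i, so it links c_a to z_i in two steps; it differs from c_a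
     because c_a is not adjacent to z_i. *)
  apply: (@dist_min _ _ _ _ [:: inl (lshift k i); inr i]) => //.
  apply/and3P; split=> //; last exact: half_cycle_adj_lshift.
  by apply: contraFneq ai => ->; have := half_cycle_adj_lshift i.
by rewrite ltn_neqAle eq_sym dist_half_cycle_eq1 [e _ _]ai lt0n dist_eq0.
Qed.

(** The index [m] stands for the pair c_m, c_(m+1), with indices modulo 2k since [ordS] wraps
    around. *)
Definition cut_pairs (s : vertex) : {set 'I_(k + k)} :=
  [set m | dist e (inl m) s != dist e (inl (ordS m)) s].

Lemma cut_pairs_inl (m : 'I_(k + k)) :
  cut_pairs (inl (ordS m)) \subset [set m; ordS m].
Proof.
apply/subsetP => i; rewrite !inE !dist_inl_inl (can_eq (@ordSK _)).
by case: (i == m); case: (i == _).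
Qed.

(** Distances to z_i are 1 on the arc from c_i to c_(i+k-1) and 2 off it, so they change only where
    the arc is entered, at c_i, and left, at c_(i+k). *)
Lemma cut_pairs_inr (i : 'I_k) :
  cut_pairs (inr i) \subset [set ord_pred (lshift k i); ord_pred (rshift k i)].
Proof.
apply/subsetP => m; rewrite !inE !dist_inl_inr.
(* Comparing successors avoids computing [ord_pred]; only [m.+1 = k + k] wraps around. *)
rewrite -!(can_eq (@ordSK _) m) !ord_predK -!(inj_eq (@ord_inj _)) !val_ordS /=.
have := ltn_ord i; have := ltn_ord m.
by case: (m.+1 =P k + k) => m_max; do 2 case: ifP; lia.
Qed.

Lemma card_cut_pairs s : #|cut_pairs s| <= 2.
Proof.
have card_set2 (a b : 'I_(k + k)) : #|[set a; b]| <= 2.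
  by rewrite cards2; case: (_ == _).
case: s => [a|i]; last exact: leq_trans (subset_leq_card (cut_pairs_inr i)) _.
by rewrite -(ord_predK a) (leq_trans (subset_leq_card (cut_pairs_inl _))).
Qed.

Lemma resolving_cut_pairs (W : {set vertex}) (m : 'I_(k + k)) :
  1 < k -> resolving e W -> exists2 w, w \in W & m \in cut_pairs w.
Proof.
move=> k_gt1 rW.
have [|w wW mw] := @resolving_separates _ _ _ (inl m) (inl (ordS m)) rW.
  rewrite (inj_eq inl_inj) -(inj_eq (@ord_inj _)) val_ordS.
  by case: ifP; lia.
by exists w; rewrite // inE.
Qed.

Lemma resolving_card_ge (W : {set vertex}) :
  1 < k -> resolving e W -> k <= #|W|.
Proof.
move=> k_gt1 rW.
have := card_le_cover card_cut_pairs (A := setT) (W := W).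
rewrite cardsT card_ord => le_kW.
suff : k + k <= #|W| * 2 by lia.
by apply: le_kW => m _; apply: resolving_cut_pairs.
Qed.

Lemma resolving_inl_card_gt (W : {set vertex}) (a : 'I_(k + k)) :
  1 < k -> resolving e W -> inl a \in W -> k < #|W|.
Proof.
move=> k_gt1 rW; rewrite -(ord_predK a); set p := ord_pred a => aW.
(* The cycle has length 2k >= 4, so three consecutive vertices are distinct. *)
have [neq_p neq_s neq_ps] :
    [/\ p != ordS p, ordS (ordS p) != ordS p & p != ordS (ordS p)].
  rewrite -!(inj_eq (@ord_inj _)); have := ltn_ord p.
  by have := val_ordS p; have := val_ordS (ordS p); do 2 case: ifP; split; lia.
have [|w wW sep_ps] :=
    @resolving_separates _ _ _ (inl p) (inl (ordS (ordS p))) rW.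
  by rewrite (inj_eq inl_inj).
have neq_w : w != inl (ordS p).
  by apply: contraNneq sep_ps => ->; rewrite !dist_inl_inl neq_p neq_s.
(* As [w] separates c_p from c_(p+2), it cuts at least one of the pairs [p] and [ordS p]; [m] is the
   other one, the only pair that may be lost with c_(p+1). *)
pose m := if p \in cut_pairs w then ordS p else p.
have cov_m : {in [set~ m], forall i,
    exists2 w', w' \in W :\ inl (ordS p) & i \in cut_pairs w'}.
  move=> i; rewrite !inE => neq_im.
  have [w' w'W iw'] := resolving_cut_pairs i k_gt1 rW.
  have [w'E|neq_w'] := eqVneq w' (inl (ordS p)); last first.
    by exists w'; rewrite // !inE neq_w'.
  exists w; first by rewrite !inE neq_w.
  have := subsetP (cut_pairs_inl p) i; rewrite -w'E => /(_ iw').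
  move: neq_im; rewrite /m !inE.
  case: (eqVneq (dist e (inl p) w)) => [eq_p | sep_p] /= /negPf-> /=.
    by move=> /eqP->; rewrite -eq_p.
  by rewrite orbF => /eqP->.
(* This gives 2k - 1 <= 2(|W| - 1); the left side is odd, so k <= |W| - 1. *)
have := card_le_cover card_cut_pairs cov_m.
rewrite cardsC1 card_ord (cardsD1 (inl (ordS p)) W) aW.
by move: #|_ :\ _|; lia.
Qed.

Definition half_cycle_basis : {set vertex} := [set inr i | i : 'I_k].

Lemma card_half_cycle_basis : #|half_cycle_basis| = k.
Proof. by rewrite card_imset ?card_ord // => i j []. Qed.

Lemma half_cycle_basis_resolving : resolving e half_cycle_basis.
Proof.
apply/resolvingP => u v same.
have {}same i : dist e u (inr i) = dist e v (inr i) by apply/same/imset_f.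
(* Distance 0 to z_i identifies z_i, which settles every case but that of two clique vertices. *)
have eq_inr i w : dist e w (inr i) = 0 -> w = inr i.
  by move/eqP; rewrite dist_eq0 => /eqP.
case: u v same => [a|i] [b|j] same; last 1 first.
- by apply: eq_inr; rewrite same; apply/eqP; rewrite dist_eq0.
- have {}same (i : 'I_k) : (i <= a < i + k) = (i <= b < i + k).
    by have := same i; rewrite !dist_inl_inr; do 2 case: ifP.
  congr inl; wlog lt_ab : a b same / a < b.
    move=> wlg; apply/val_inj; case: (ltngtP a b) => // lt_ab.
      by rewrite (wlg a b).
    by rewrite (wlg b a).
  (* If b < k, then z_b is adjacent to c_b but not to c_a. Otherwise the arc of z_(b-k) ends just
     before c_b; it contains c_a unless a < b - k, and then z_a is adjacent to c_a but not to
     c_b. *)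
  have lt_b := ltn_ord b; have [lt_bk|le_kb] := ltnP b k.
    by have := same (Ordinal lt_bk) => /=; lia.
  have lt_bkk : b - k < k by lia.
  have := same (Ordinal lt_bkk) => /=; have [le_bka|lt_abk] := leqP (b - k) a.
    lia.
  have lt_ak : a < k by lia.
  by have := same (Ordinal lt_ak) => /=; lia.
- by apply: eq_inr; rewrite same; apply/eqP; rewrite dist_eq0.
- by apply/esym/eq_inr; rewrite -same; apply/eqP; rewrite dist_eq0.
Qed.

Lemma half_cycle_basis_unique (W : {set vertex}) :
  1 < k -> resolving e W -> #|W| <= k -> W = half_cycle_basis.
Proof.
move=> k_gt1 rW leWk; apply/eqP.
rewrite eqEcard card_half_cycle_basis resolving_card_ge // andbT.
apply/subsetP => -[a aW|i _]; last exact: imset_f.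
by have := resolving_inl_card_gt k_gt1 rW aW; rewrite ltnNge leWk.
Qed.

End HalfCycleGraph.

Theorem theorem9 (k : nat) (hk : 2 <= k) :
  exists (T : finType) (e : rel T),
    [/\ simple_graph e,
        connected_graph e,
        #|T| = 3 * k,
        metric_dimension e = k
      & exists! W : {set T}, metric_basis e W].
Proof.
have basisP : metric_basis (@half_cycle_adj k) (half_cycle_basis k).
  rewrite /metric_basis half_cycle_basis_resolving card_half_cycle_basis.
  by apply/forallP => W; apply/implyP; apply: resolving_card_ge.
exists ('I_(k + k) + 'I_k)%type, (@half_cycle_adj k); split.
- by split; [apply: half_cycle_sym | apply: half_cycle_irr].
- exact: half_cycle_connected.
- by rewrite card_sum !card_ord; lia.
- by rewrite -(card_metric_basis basisP) card_half_cycle_basis.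
- exists (half_cycle_basis k); split=> // W /andP[rW /forallP minW].
  apply/esym/half_cycle_basis_unique => //.
  rewrite -[X in _ <= X](card_half_cycle_basis k).
  exact: (implyP (minW _)) (half_cycle_basis_resolving k).
Qed.
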